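(* Let $F$ be a non-abelian free group, let $k>0$ be an integer and let $\alpha\in \mathrm{H}_b^k(F,\mathbb{R})$ be arbitrary. Let $\phi:F\to\mathbb{R}$ be a quasimorphism, so that $\delta^1\phi$ is a bounded $2$-cocycle with class $[\delta^1\phi]\in \mathrm{H}^2_b(F,\mathbb{R})$. Then the cup product $$[\delta^1\phi]\cup\alpha \in \mathrm{H}_b^{k+2}(F,\mathbb{R})$$ vanishes, i.e. $[\delta^1\phi]\cup\alpha=0$, whenever one of the following holds: (a) $\phi$ is a $\Delta$-decomposable quasimorphism; (b) $\phi$ is a Brooks quasimorphism; (c) $\phi$ is a Rolli quasimorphism.
   Context: Bounded cohomology. For a group $G$ and $n\ge 0$ let $\mathrm{C}^n(G,\mathbb{R})$ be the space of functions $\varphi:G^n\to\mathbb{R}$ and $\mathrm{C}^n_b(G,\mathbb{R})$ the subspace of bounded functions. The coboundary $\delta^n:\mathrm{C}^n(G,\mathbb{R})\to \mathrm{C}^{n+1}(G,\mathbb{R})$ is $$\delta^n(\varphi)(g_1,\dots,g_{n+1})=\varphi(g_2,\dots,g_{n+1})+\sum_{j=1}^n(-1)^j\varphi(g_1,\dots,g_jg_{j+1},\dots,g_{n+1})+(-1)^{n+1}\varphi(g_1,\dots,g_n).$$ It preserves bounded cochains, and $\mathrm{H}^n_b(G,\mathbb{R})$ is the $n$-th cohomology of the complex $(\mathrm{C}^*_b(G,\mathbb{R}),\delta^* )$. The cup product $\mathrm{H}^n_b(G,\mathbb{R})\times \mathrm{H}^m_b(G,\mathbb{R})\to \mathrm{H}^{n+m}_b(G,\mathbb{R})$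 is $[f]\cup[h]=[f\cup h]$, where $(f\cup h)(g_1,\dots,g_{n+m})=f(g_1,\dots,g_n)\,h(g_{n+1},\dots,g_{n+m})$. A quasimorphism on $G$ is a map $\phi:G\to\mathbb{R}$ with $\sup_{g,h\in G}|\phi(g)+\phi(h)-\phi(gh)|<\infty$; equivalently $\delta^1\phi$ is bounded. Let $\mathcal{S}$ be the symmetrization (the set together with its inverses) of a free generating set of $F$; reduced words are taken with respect to $\mathcal{S}$. Brooks quasimorphisms. Let $w\in F$ be a non-trivial element, of reduced length $\ell$ (selfoverlapping or not). Define $\chi_w:F\to\{1,0,-1\}$ by $\chi_w(w)=1$, $\chi_w(w^{-1})=-1$ and $\chi_w(g)=0$ otherwise. The Brooks quasimorphism on $w$ is $\phi_w:F\to\mathbb{Z}$, $$\phi_w(g)=\sum_{j=1}^{m-\ell+1}\chi_w(x_j\cdots x_{j+\ell-1})$$ where $g=x_1\cdots x_m$ is the reduced expression of $g$ of length $m$ (the sum is $0$ if $m<\ell$). Rolli quasimorphisms. Let $\mathcal{S}=\{x_1,\dots,x_{\mathbf n}\}\cup\{x_1^{-1},\dots,x_{\mathbf n}^{-1}\}$ be the symmetrization of a free generating set $\{x_1,\dots,x_{\mathbf n}\}$ of $F$ (so in this case $F$ has rank $\mathbf n$). Let $\lambda_1,\dots,\lambda_{\mathbf n}:\mathbb{Z}\to\mathbb{R}$ be bounded alternating functions, where alternating means $\lambda_j(-m)=-\lambda_j(m)$ for all $m\in\mathbb{Z}$. The associated Rolli quasimorphism is $\phi:F\to\mathbb{R}$,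 $\phi(g)=\sum_{i=1}^k\lambda_{j_i}(m_i)$, where $g=x_{j_1}^{m_1}\cdots x_{j_k}^{m_k}$ is the unique expression of $g$ with all $m_i$ non-zero integers and no two consecutive $j_i$ equal (the empty sum for $g=\mathrm{id}$ is $0$). $\Delta$-decompositions. Let $\mathcal{P}\subset F$ be a symmetric set (closed under inverses) with $\mathrm{id}\notin\mathcal{P}$; its elements are called pieces. Let $\mathcal{P}^*$ be the set of finite sequences of elements of $\mathcal{P}$, including the empty sequence; write $|s|$ for the number of entries of $s\in\mathcal{P}^*$, and juxtaposition of sequences for concatenation. A $\Delta$-decomposition of $F$ into the pieces $\mathcal{P}$ is a map $\Delta:F\to\mathcal{P}^*$ such that: [A] For every $g\in F$ with $\Delta(g)=(g_1,\dots,g_K)$: $g=g_1\cdots g_K$ as a reduced word (no cancellation occurs when concatenating the reduced words of $g_1,\dots,g_K$); $\Delta(g^{-1})=(g_K^{-1},\dots,g_1^{-1})$; and $\Delta(g_i\cdots g_j)=(g_i,\dots,g_j)$ for all $1\le i\le j\le K$. [B] There is a constant $R>0$ such that for all $g,h\in F$, when the sequences are written in the form $$\Delta(g)=\Delta(c_1^{-1})\Delta(r_1)\Delta(c_2),\quad \Delta(h)=\Delta(c_2^{-1})\Delta(r_2)\Delta(c_3),\quad \Delta(gh)=\Delta(c_1^{-1})\Delta(r_3^{-1})\Delta(c_3)$$ with $\Delta(c_i),\Delta(r_i)\in\mathcal{P}^*$ and the $\Delta(c_i)$ of maximal length, one has $|\Delta(r_i)|\le R$ for $i=1,2,3$. $\Delta$-decomposable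 quasimorphisms. Given a $\Delta$-decomposition $\Delta$ of $F$ into pieces $\mathcal{P}$ and a bounded function $\lambda:\mathcal{P}\to\mathbb{R}$ that is alternating, i.e. $\lambda(p^{-1})=-\lambda(p)$ for all $p\in\mathcal{P}$, the map $\phi_{\lambda,\Delta}:F\to\mathbb{R}$, $\phi_{\lambda,\Delta}(g)=\sum_{j=1}^K\lambda(g_j)$ where $\Delta(g)=(g_1,\dots,g_K)$, is called a $\Delta$-decomposable quasimorphism (it is known to be a quasimorphism). A quasimorphism is called $\Delta$-decomposable if it is of this form for some $\Delta$-decomposition $\Delta$ and some such $\lambda$. *)

(* Defs.v *)
(* Groups are (possibly infinite) MathComp [groupType]s; the real numbers are an
   arbitrary MathComp-Analysis [R : realType]. *)
From HB Require Import structures.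
From mathcomp Require Import all_boot all_order all_algebra.
From mathcomp Require Import boolp classical_sets functions reals.
From mathcomp Require Import ring.

Set Implicit Arguments.
Unset Strict Implicit.
Unset Printing Implicit Defensive.

Import Order.TTheory GRing.Theory Num.Theory.

Local Open Scope ring_scope.
Local Open Scope quotient_scope.

Section Cochains.
Variables (R : realType) (G : groupType).

(* A point of G^n is a function 'I_n -> G; indices are shifted to start at 0. *)
Definition cochain (n : nat) : Type := ('I_n -> G) -> R.

HB.instance Definition _ n :=
  GRing.Zmodule.copy (cochain n) (('I_n -> G) -> R).

Definition bounded_cochain n (f : cochain n) : Prop :=
  exists M : R, forall g, `|f g| <= M.

(* (g_0, ..., g_n) |-> (g_0, ..., g_j * g_(j+1), ..., g_n) *)
Definition merge n (j : 'I_n) (g : 'I_n.+1 -> G) : 'I_n -> G :=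
  fun i => if (i < j)%N then g (widen_ord (leqnSn n) i)
           else if i == j then (g (widen_ord (leqnSn n) i) * g (lift ord0 i))%g
           else g (lift ord0 i).

Definition delta n (f : cochain n) : cochain n.+1 :=
  fun g => f (fun i => g (lift ord0 i))
           + \sum_(j < n) (-1) ^+ j.+1 * f (merge j g)
           + (-1) ^+ n.+1 * f (fun i => g (widen_ord (leqnSn n) i)).

Definition cup_cochain n m (f : cochain n) (h : cochain m) : cochain (n + m) :=
  fun g => f (fun i => g (lshift m i)) * h (fun i => g (rshift n i)).

Lemma deltaB n (f h : cochain n) : delta (f - h) = delta f - delta h.
Proof.
apply/funext => g; rewrite /delta -[LHS]/(_ + _ + _) /=.
rewrite -[RHS]/((_ + _ + _) - (_ + _ + _)).
have -> : \sum_(j < n) (-1) ^+ j.+1 * (f - h) (merge j g) =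
    \sum_(j < n) (-1) ^+ j.+1 * f (merge j g)
    - \sum_(j < n) (-1) ^+ j.+1 * h (merge j g).
  by rewrite -sumrB; apply: eq_bigr => j _; rewrite -mulrBr.
have E x : (f - h) x = f x - h x by [].
by rewrite !E mulrBr; ring.
Qed.

Lemma bounded_cochain0 n : bounded_cochain (0 : cochain n).
Proof. by exists 0 => g; rewrite normr0. Qed.

Lemma bounded_cochainB n (f h : cochain n) :
  bounded_cochain f -> bounded_cochain h -> bounded_cochain (f - h).
Proof.
move=> [M fM] [N hN]; exists (M + N) => g.
by apply: (le_trans (ler_normB _ _)); apply: lerD.
Qed.

Lemma bounded_cup_cochain n m (f : cochain n) (h : cochain m) :
  bounded_cochain f -> bounded_cochain h -> bounded_cochain (cup_cochain f h).
Proof.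
move=> [M fM] [N hN]; exists (M * N) => g.
by rewrite normrM ler_pM.
Qed.

Lemma delta0 n : delta (0 : cochain n) = 0.
Proof. by rewrite -(subrr (0 : cochain n)) deltaB subrr. Qed.

Definition first_args n m (g : 'I_(n + m).+1 -> G) : 'I_n.+1 -> G :=
  fun i => g (widen_ord (leq_addr m n : n < (n + m).+1)%N i).

Definition last_args n m (g : 'I_(n + m).+1 -> G) : 'I_m.+1 -> G :=
  fun i => g (cast_ord (addnS n m) (rshift n i)).

Lemma delta_cup n m (f : cochain n) (h : cochain m) (g : 'I_(n + m).+1 -> G) :
  delta (cup_cochain f h) g =
    delta f (first_args g) * h (fun i => last_args g (lift ord0 i))
    + (-1) ^+ n * f (fun i => first_args g (widen_ord (leqnSn n) i))
      * delta h (last_args g).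
Proof.
rewrite /delta big_split_ord /=.
have gE (i j : 'I_(n + m).+1) : i = j :> nat -> g i = g j.
  by move=> ij; congr g; apply: val_inj.
have -> : cup_cochain f h (fun i => g (lift ord0 i)) =
    f (fun i => first_args g (lift ord0 i))
    * h (fun i => last_args g (lift ord0 i)).
  rewrite /cup_cochain; congr (_ * _); [congr f|congr h];
    apply/funext => i; apply: gE => /=.
  - by rewrite /bump /=.
  - by rewrite /bump /= !add1n addnS.
have -> : cup_cochain f h (fun i => g (widen_ord (leqnSn (n + m)) i)) =
    f (fun i => first_args g (widen_ord (leqnSn n) i))
    * h (fun i => last_args g (widen_ord (leqnSn m) i)).
  by rewrite /cup_cochain; congr (_ * _); [congr f|congr h];
    apply/funext => i; apply: gE.
have -> : \sum_(i < n)
      (-1) ^+ i.+1 * cup_cochain f h (merge (lshift m i) g) =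
    (\sum_(j < n) (-1) ^+ j.+1 * f (merge j (first_args g)))
    * h (fun i => last_args g (lift ord0 i)).
  rewrite mulr_suml; apply: eq_bigr => j _; rewrite -mulrA; congr (_ * _).
  rewrite /cup_cochain; congr (_ * _); [congr f|congr h];
    apply/funext => i; rewrite /merge /=.
  - rewrite /first_args -!val_eqE /=; case: ifP => _; first exact: gE.
    by case: ifP => _; [congr (_ * _)%g; apply: gE|apply: gE].
  - have ji : (j < n + i)%N by rewrite (leq_trans (ltn_ord j)) ?leq_addr.
    rewrite ltnNge (ltnW ji) /= -val_eqE /= gtn_eqF //.
    by apply: gE; rewrite /= /bump /= !add1n addnS.
have -> : \sum_(i < m)
      (-1) ^+ (n + i).+1 * cup_cochain f h (merge (rshift n i) g) =
    (-1) ^+ n * f (fun i => first_args g (widen_ord (leqnSn n) i))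
    * \sum_(j < m) (-1) ^+ j.+1 * h (merge j (last_args g)).
  rewrite mulr_sumr; apply: eq_bigr => j _; rewrite -addnS exprD -!mulrA.
  congr (_ * _); rewrite mulrCA /cup_cochain.
  congr (_ * _); [congr f|congr (_ * _); congr h];
    apply/funext => i; rewrite /merge /=.
  - by rewrite (leq_trans (ltn_ord i)) ?leq_addr //; apply: gE.
  - rewrite /last_args ltn_add2l -!val_eqE /= eqn_add2l.
    case: ifP => _; first exact: gE.
    by case: ifP => _; [congr (_ * _)%g|]; apply: gE;
       rewrite //= /bump /= !add1n addnS.
rewrite -addnS exprD !exprS; ring.
Qed.

Definition bcocycle_pred n (f : cochain n) : bool :=
  `[< bounded_cochain f /\ delta f = 0 >].

Lemma bcocycle_zmod_closed n : zmod_closed (@bcocycle_pred n).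
Proof.
split=> [|f h]; rewrite !unfold_in.
  by apply/asboolP; split; [exact: bounded_cochain0|rewrite delta0].
move=> /asboolP[bf df] /asboolP[bh dh]; apply/asboolP.
by split; [exact: bounded_cochainB|rewrite deltaB df dh subrr].
Qed.

HB.instance Definition _ n :=
  GRing.isZmodClosed.Build (cochain n) (@bcocycle_pred n)
    (bcocycle_zmod_closed n).

Record bcocycle (n : nat) : Type := BCocycle {
  bcocycle_val :> cochain n;
  _ : bcocycle_val \in @bcocycle_pred n }.

HB.instance Definition _ n := [isSub for @bcocycle_val n].
HB.instance Definition _ n := [Choice of bcocycle n by <:].
HB.instance Definition _ n := [SubChoice_isSubZmodule of bcocycle n by <:].

Definition bcocycle_of n (f : cochain n) (bf : bounded_cochain f)
    (df : delta f = 0) : bcocycle n :=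
  @BCocycle n f (asboolT (conj bf df)).

Lemma bcocycleP n (f : bcocycle n) :
  bounded_cochain f /\ delta (bcocycle_val f) = 0.
Proof. by case: f => f /= /asboolP. Qed.

(* The complex starts in degree 0, so the only coboundary there is 0. *)
Definition bcoboundary n : cochain n -> Prop :=
  match n return cochain n -> Prop with
  | 0 => fun f => f = 0
  | p.+1 => fun f => exists2 c : cochain p, bounded_cochain c & f = delta c
  end.

Definition bcoboundary_pred n (z : bcocycle n) : bool :=
  `[< bcoboundary (bcocycle_val z) >].

Lemma bcoboundary_zmod_closed n : zmod_closed (@bcoboundary_pred n).
Proof.
split=> [|f h]; rewrite !unfold_in.
  apply/asboolP; case: n => [//|n] /=; exists 0; first exact: bounded_cochain0.
  by rewrite delta0.
case: n f h => [|n] f h /asboolP /= fb /asboolP /= hb; apply/asboolP => /=.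
  by rewrite fb hb subrr.
case: fb hb => c bc -> [d bd ->]; exists (c - d); last by rewrite deltaB.
exact: bounded_cochainB.
Qed.

HB.instance Definition _ n :=
  GRing.isZmodClosed.Build (bcocycle n) (@bcoboundary_pred n)
    (bcoboundary_zmod_closed n).

Definition bcoboundaries n : zmodClosed (bcocycle n) :=
  GRing.ZmodClosed.clone (bcocycle n) (@bcoboundary_pred n) _.

(* Bounded cohomology H^n_b(G, R): bounded cocycles modulo the coboundaries of
   bounded cochains. *)
Definition Hb (n : nat) : zmodType := Quotient.quot (bcoboundaries n).

Definition Hb_class n (z : bcocycle n) : Hb n :=
  \pi_(Quotient.quot (bcoboundaries n)) z.

Lemma Hb_class_eq n (z t : bcocycle n) :
  Hb_class z = Hb_class t <-> bcoboundary (bcocycle_val z - bcocycle_val t).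
Proof.
rewrite /Hb_class; split=> [|H].
  by move=> /eqP; rewrite -Quotient.idealrBE => /asboolP.
by apply/eqP; rewrite -Quotient.idealrBE; apply/asboolP.
Qed.

Lemma Hb_class_eq0 n (z : bcocycle n) :
  Hb_class z = 0 <-> bcoboundary (bcocycle_val z).
Proof.
have -> : (0 : Hb n) = Hb_class 0 by rewrite /Hb_class raddf0.
by rewrite Hb_class_eq subr0.
Qed.

Lemma cup_bcocycle_subproof n m (f : bcocycle n) (h : bcocycle m) :
  delta (cup_cochain (bcocycle_val f) (bcocycle_val h)) = 0.
Proof.
have [_ df] := bcocycleP f; have [_ dh] := bcocycleP h.
by apply/funext => g; rewrite delta_cup df dh mul0r mulr0 addr0.
Qed.

Definition cup_bcocycle n m (f : bcocycle n) (h : bcocycle m) :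
    bcocycle (n + m) :=
  bcocycle_of
    (bounded_cup_cochain (proj1 (bcocycleP f)) (proj1 (bcocycleP h)))
    (cup_bcocycle_subproof f h).

(* Defined on canonical representatives; [cupE] below is [f] u [h] = [f u h]. *)
Definition cup n m (a : Hb n) (b : Hb m) : Hb (n + m) :=
  Hb_class (cup_bcocycle (repr a) (repr b)).

Lemma bcoboundary_cast n N (eN : N = n.+1) (f : cochain N) (c : cochain n) :
  bounded_cochain c ->
  (forall g, f g = delta c (fun i => g (cast_ord (esym eN) i))) ->
  bcoboundary f.
Proof.
subst N => bc fE; exists c => //; apply/funext => g; rewrite fE.
by congr delta; apply/funext => i; congr g; apply: val_inj.
Qed.

Lemma cup_bcoboundaryl n m (f : cochain n) (h : bcocycle m) :
  bcoboundary f -> bcoboundary (cup_cochain f (bcocycle_val h)).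
Proof.
have [bh dh] := bcocycleP h; case: n f => [|n] f /=.
  move=> ->; have -> : cup_cochain 0 (bcocycle_val h) = 0.
    by move=> n; apply/funext => g; rewrite /cup_cochain mul0r.
  case: m h bh dh => [//|m] h bh dh; exists 0; last by rewrite delta0.
  exact: bounded_cochain0.
move=> [c bc ->]; exists (cup_cochain c (bcocycle_val h)).
  exact: bounded_cup_cochain.
apply/funext => g; rewrite delta_cup dh mulr0 addr0 /cup_cochain.
congr (_ * _); [congr (delta c _)|congr (bcocycle_val h _)];
  apply/funext => i; congr g; apply: val_inj => //=.
by rewrite /bump /= add1n addnS addSn.
Qed.

Lemma cup_bcoboundaryr n m (f : bcocycle n) (h : cochain m) :
  bcoboundary h -> bcoboundary (cup_cochain (bcocycle_val f) h).
Proof.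
have [bf df] := bcocycleP f; case: m h => [|m] h /=.
  move=> ->; have -> : cup_cochain (bcocycle_val f) (0 : cochain 0) = 0.
    by apply/funext => g; rewrite /cup_cochain mulr0.
  case: (n + 0)%N => [//|p]; exists 0; last by rewrite delta0.
  exact: bounded_cochain0.
move=> [c bc ->].
pose c' : cochain (n + m) :=
  fun g => (-1) ^+ n * cup_cochain (bcocycle_val f) c g.
have c'E : delta c' = fun g => (-1) ^+ n * delta (cup_cochain f c) g.
  apply/funext => g; rewrite /delta /c' !mulrDr mulr_sumr; congr (_ + _ + _).
    by apply: eq_bigr => j _; rewrite mulrCA.
  by rewrite mulrCA.
apply: (@bcoboundary_cast _ _ (addnS n m) _ c').
  have [M cM] := bounded_cup_cochain bf bc.
  by exists M => g; rewrite normrM normrX normrN1 expr1n mul1r.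
move=> g; rewrite c'E delta_cup df mul0r add0r !mulrA -exprD addnn -mul2n.
rewrite exprM sqrrN expr1n expr1n mul1r /cup_cochain.
congr (_ * _); [congr (bcocycle_val f _)|congr (delta c _)];
  by apply/funext => i; congr g; apply: val_inj.
Qed.

Lemma cupE n m (f : bcocycle n) (h : bcocycle m) :
  cup (Hb_class f) (Hb_class h) = Hb_class (cup_bcocycle f h).
Proof.
have reprE p (z : bcocycle p) :
    bcoboundary (bcocycle_val (repr (Hb_class z)) - bcocycle_val z).
  by apply/Hb_class_eq; rewrite /Hb_class reprK.
set f' := repr (Hb_class f); set h' := repr (Hb_class h).
have -> : cup (Hb_class f) (Hb_class h) = Hb_class (cup_bcocycle f' h') by [].
transitivity (Hb_class (cup_bcocycle f h')); apply/Hb_class_eq => /=.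
  have -> : cup_cochain (bcocycle_val f') (bcocycle_val h')
      - cup_cochain (bcocycle_val f) (bcocycle_val h') =
      cup_cochain (bcocycle_val f' - bcocycle_val f) (bcocycle_val h').
    by apply/funext => g; rewrite /cup_cochain mulrBl.
  exact: cup_bcoboundaryl (reprE _ f).
have -> : cup_cochain (bcocycle_val f) (bcocycle_val h')
    - cup_cochain (bcocycle_val f) (bcocycle_val h) =
    cup_cochain (bcocycle_val f) (bcocycle_val h' - bcocycle_val h).
  by apply/funext => g; rewrite /cup_cochain mulrBr.
exact: cup_bcoboundaryr (reprE _ h).
Qed.

Definition quasimorphism (phi : G -> R) : Prop :=
  exists D : R, forall g h, `|phi g + phi h - phi (g * h)%g| <= D.

Definition cochain1 (phi : G -> R) : cochain 1 := fun g => phi (g ord0).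

Lemma delta_cochain1 (phi : G -> R) (g : 'I_2 -> G) :
  delta (cochain1 phi) g =
    phi (g ord0) + phi (g ord_max) - phi (g ord0 * g ord_max)%g.
Proof.
rewrite /delta big_ord1 /cochain1 /merge /= expr1 sqrrN expr1n mulN1r mul1r.
have -> : widen_ord (leqnSn 1) ord0 = ord0 :> 'I_2 by apply: val_inj.
have -> : lift ord0 ord0 = ord_max :> 'I_2 by apply: val_inj.
by ring.
Qed.

Lemma bounded_delta_qm (phi : G -> R) :
  quasimorphism phi -> bounded_cochain (delta (cochain1 phi)).
Proof. by move=> [D phiD]; exists D => g; rewrite delta_cochain1. Qed.

Lemma delta_delta_cochain1 (phi : G -> R) : delta (delta (cochain1 phi)) = 0.
Proof.
apply/funext => g; rewrite -[RHS]/(0 : R) {1}/delta !big_ord_recr big_ord0 /=.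
rewrite !delta_cochain1 /merge /=.
have gE (i j : 'I_3) : i = j :> nat -> g i = g j.
  by move=> ij; congr g; apply: val_inj.
rewrite (gE (lift ord0 ord_max) ord_max) // (gE (widen_ord _ ord0) ord0) //.
rewrite (gE (widen_ord _ ord_max) (lift ord0 ord0)) // mulgA; ring.
Qed.

Definition qm_cocycle (phi : G -> R) (qphi : quasimorphism phi) : bcocycle 2 :=
  bcocycle_of (bounded_delta_qm qphi) (delta_delta_cochain1 phi).

End Cochains.

Section FreeGroups.
Variables (R : realType) (F : groupType).
Implicit Types (B P : set F) (s : seq F) (phi : F -> R).
Local Open Scope classical_set_scope.

Definition symmetrization B : set F := B `|` [set b^-1%g | b in B].

Definition reduced_word B s : Prop :=
  (forall a, a \in s -> symmetrization B a)
  /\ sorted (fun a b => a * b != 1)%g s.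

(* The first clause makes the letters b and b^-1 (b in B) pairwise distinct, so
   that words in the symmetrization of B are words in formal letters. *)
Definition free_generating_set B : Prop :=
  (forall b, B b -> ~ B b^-1%g)
  /\ forall g : F, exists! s, reduced_word B s /\ (\prod_(a <- s) a)%g = g.

(* The reduced expression of g; meaningful when B is a free generating set. *)
Definition rword B (g : F) : seq F :=
  xget [::] [set s | reduced_word B s /\ (\prod_(a <- s) a)%g = g].

Definition brooks_chi (w g : F) : int :=
  if g == w then 1 else if g == w^-1%g then -1 else 0.

(* With truncated subtraction the sum is empty when m < l. *)
Definition brooks B (w g : F) : int :=
  let x := rword B g in let m := size x in let l := size (rword B w) in
  \sum_(j < m.+1 - l) brooks_chi w (\prod_(a <- take l (drop j x)) a)%g.

Definition is_brooks B phi : Prop :=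
  exists2 w : F, w != 1%g & forall g, phi g = (brooks B w g)%:~R.

Definition zpow (g : F) (m : int) : F :=
  match m with Posz k => (g ^+ k)%g | Negz k => (g ^- k.+1)%g end.

Definition syllable_word n (t : seq ('I_n * int)) : Prop :=
  all (fun p => p.2 != 0) t /\ sorted (fun p q => p.1 != q.1) t.

Definition syllables n (x : 'I_n -> F) (g : F) : seq ('I_n * int) :=
  xget [::] [set t | syllable_word t
                     /\ (\prod_(p <- t) zpow (x p.1) p.2)%g = g].

Definition rolli n (x : 'I_n -> F) (lambda : 'I_n -> int -> R) (g : F) : R :=
  \sum_(p <- syllables x g) lambda p.1 p.2.

Definition is_rolli B phi : Prop :=
  exists (n : nat) (x : 'I_n -> F) (lambda : 'I_n -> int -> R),
    [/\ injective x,
        B = range x,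
        forall j, exists M, forall m, `|lambda j m| <= M,
        forall j m, lambda j (- m) = - lambda j m
      & forall g, phi g = rolli x lambda g].

Definition three_part (Delta : F -> seq F) (g h c1 c2 c3 r1 r2 r3 : F) : Prop :=
  [/\ Delta g = Delta c1^-1%g ++ Delta r1 ++ Delta c2,
      Delta h = Delta c2^-1%g ++ Delta r2 ++ Delta c3
    & Delta (g * h)%g = Delta c1^-1%g ++ Delta r3^-1%g ++ Delta c3].

(* The three lengths are maximised simultaneously; the maxima are attained
   together because, there being no cancellation between pieces, the maximal
   common prefixes and suffixes of the three sequences do not overlap. *)
Definition maximal_three_part Delta (g h c1 c2 c3 r1 r2 r3 : F) : Prop :=
  three_part Delta g h c1 c2 c3 r1 r2 r3
  /\ forall d1 d2 d3 t1 t2 t3, three_part Delta g h d1 d2 d3 t1 t2 t3 ->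
       [/\ size (Delta d1) <= size (Delta c1),
           size (Delta d2) <= size (Delta c2)
         & size (Delta d3) <= size (Delta c3)]%N.

Record delta_decomposition B P (Delta : F -> seq F) : Prop := {
  pieces_sym : forall p, P p -> P p^-1%g;
  pieces_neq1 : ~ P 1%g;
  delta_pieces : forall g p, p \in Delta g -> P p;
  delta_reduced : forall g,
    rword B g = flatten [seq rword B p | p <- Delta g];
  delta_inv : forall g, Delta g^-1%g = rev [seq p^-1%g | p <- Delta g];
  delta_infix : forall g s1 s s2, Delta g = s1 ++ s ++ s2 -> s != [::] ->
    Delta (\prod_(p <- s) p)%g = s;
  delta_bounded : exists2 C : nat, (0 < C)%N &
    forall g h c1 c2 c3 r1 r2 r3,
      maximal_three_part Delta g h c1 c2 c3 r1 r2 r3 ->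
      [/\ size (Delta r1) <= C, size (Delta r2) <= C
        & size (Delta r3) <= C]%N }.

(* lambda is only constrained, and only used, on the pieces. *)
Definition is_decomposable B phi : Prop :=
  exists (P : set F) (Delta : F -> seq F) (lambda : F -> R),
    [/\ delta_decomposition B P Delta,
        exists M, forall p, P p -> `|lambda p| <= M,
        forall p, P p -> lambda p^-1%g = - lambda p
      & forall g, phi g = \sum_(p <- Delta g) lambda p].

End FreeGroups.

(* Main.v *)
Require Import Defs.
From mathcomp Require Import all_boot all_order all_algebra.
From mathcomp Require Import boolp classical_sets functions reals.
From mathcomp Require Import zify ring lra.

(** The cochain phi u a, for a bounded cocycle a representing alpha, satisfies
    delta (phi u a) = delta phi u a, but it is unbounded in general.  The proof
    corrects it by a coboundary delta eta that makes it bounded.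

    Suppose that phi(g) is the sum of the weights lambda(p) over the windows p of
    a word D(g) representing g.  A window p cuts D(g) as u p z, and eta replaces
    the constant value phi(g) by a combination of values of a at the two
    endpoints z and p z of the window:
      eta(g_1, ..., g_k) = sum_p lambda(p)
                 * (a(z, g_2, ..., g_k) + a(p z, g_2, ..., g_k)) / 2.
    The cocycle relation of a at (z, g_2, ..., g_(k+1)), for z an endpoint, turns
    (phi u a + delta eta)(g_1, ..., g_(k+1)) into
      E(g_1)(f(. g_2)) + E(g_2)(f) - E(g_1 g_2)(f),
    where E(g) is the finite combination of endpoints weighted by lambda / 2
    and f is the bounded function
    z |-> a(z, g_3, ..., g_(k+1)).  Hence it suffices that E be a quasi-cocycle
    ([cup_eq0_of_quasi_cocycle]).

    The words D(g), D(h), D(g h) agree along the sides of a tripod up to bounded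
    pieces ([thin_triangles]).  On the two branches towards the ends of D(g h),
    the windows have the same endpoints on both sides and cancel.  On the
    cancelled branch c in D(g) = ... c, D(h) = c^-1 ..., a window p of c occurs
    reversed in c^-1 with the opposite weight and with its two endpoints
    exchanged; since both endpoints carry the same coefficient, these
    contributions cancel exactly ([window_sum_winv]).  Only a bounded number of
    windows, at the centre of the tripod, survives ([cup_eq0_of_windows]).

    It remains to exhibit D in each case.  For a Brooks quasimorphism D(g) is the
    reduced word and the windows have the length of w; overlapping occurrences
    of w are harmless, because windows are summed one by one.  For the other two
    quasimorphisms the windows are single entries, of the decomposition of g in
    one case and of its syllable expression in the other. *)

Set Implicit Arguments.
Unset Strict Implicit.
Unset Printing Implicit Defensive.

Import Order.TTheory GRing.Theory Num.Theory.

Local Open Scope ring_scope.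

(** * The coboundary as an alternating sum of faces *)

Section Faces.
Variables (R : realType) (G : groupType).
Implicit Types u : nat -> G.

Definition on_nat n (f : cochain R G n) (u : nat -> G) : R :=
  f (fun i => u i).

(** Working with infinite sequences gives one formula for all the faces.  The
    face of index 0 drops the first entry; the face of index n leaves the first
    n.-1 entries alone, so a cochain that reads only these sees the last of n
    entries dropped. *)
Definition face (j : nat) (u : nat -> G) : nat -> G :=
  fun i => if (i.+1 < j)%N then u i
           else if i.+1 == j then (u i * u i.+1)%g else u i.+1.

Lemma on_nat_ext n (f : cochain R G n) u v :
  (forall i, (i < n)%N -> u i = v i) -> on_nat f u = on_nat f v.
Proof.
by move=> uv; rewrite /on_nat; congr (f _); apply/funext => i; apply: uv.
Qed.

Lemma on_nat_surj n (g : 'I_n -> G) : exists u, g = fun i => u i.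
Proof.
exists (fun i => if insub i is Some k then g k else 1%g).
by apply/funext => i; rewrite valK.
Qed.

Lemma delta_faces n (f : cochain R G n) u :
  on_nat (delta f) u = \sum_(j < n.+2) (-1) ^+ j * on_nat f (face j u).
Proof.
rewrite big_ord_recl big_ord_recr /= /on_nat /delta expr0 mul1r addrA.
congr (_ + _ + _).
congr (_ * (f _)); apply/funext => i.
  by rewrite /face /= /bump /= !add1n ltnS ltn_ord.
Qed.

Lemma face_face i j u : (i <= j)%N ->
  face i (face j.+1 u) = face j (face i u).
Proof.
move=> ij; apply/funext => l; rewrite /face.
by repeat (case: ifP => ? //; try (exfalso; lia)); rewrite ?mulgA.
Qed.

(** Passing from n to n.+1 adds the row j = n.+1 and the column i = n; the
    symmetry of a pairs their entries, with opposite signs. *)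
Lemma alternating_double_sum (a : nat -> nat -> R) n :
  (forall i j, (i <= j)%N -> a i j.+1 = a j i) ->
  \sum_(j < n.+1) \sum_(i < n) (-1) ^+ j * ((-1) ^+ i * a i j) = 0.
Proof.
move=> aE; elim: n => [|n IHn].
  by rewrite big1 // => j _; rewrite big_ord0.
rewrite big_ord_recr /=.
under eq_bigr do rewrite big_ord_recr /=.
rewrite big_split /= IHn add0r -big_split /= big1 // => i _.
by rewrite aE -1?ltnS // exprS; ring.
Qed.

Lemma delta_delta n (f : cochain R G n) : delta (delta f) = 0.
Proof.
apply/funext => g; have [u ->] := on_nat_surj g.
rewrite -/(on_nat (delta (delta f)) u) delta_faces.
under eq_bigr do rewrite delta_faces mulr_sumr.
apply: (alternating_double_sum (a := fun i j => on_nat f (face i (face j u)))).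
by move=> i j ij; rewrite face_face.
Qed.

End Faces.

(** * A vanishing criterion for cup products *)

Section Criterion.
Variables (R : realType) (G : groupType).

Definition with_head (z : G) (u : nat -> G) : nat -> G :=
  fun i => if i is 0 then z else u i.

(** The list c stands for the element of the real group algebra of G that is the
    sum of the r z over the pairs (r, z) in c. *)
Definition pairing (c : seq (R * G)) (f : G -> R) : R :=
  \sum_(p <- c) p.1 * f p.2.

Lemma pairing_sum c n (a : 'I_n -> R) (F : 'I_n -> G -> R) :
  pairing c (fun z => \sum_(i < n) a i * F i z)
  = \sum_(i < n) a i * pairing c (F i).
Proof.
rewrite /pairing; under eq_bigr do rewrite mulr_sumr.
rewrite exchange_big /=; apply: eq_bigr => i _; rewrite mulr_sumr.
by apply: eq_bigr => p _; rewrite mulrCA.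
Qed.

Lemma pairingB c F b :
  pairing c (fun z => F z - b) = pairing c F - pairing c (fun=> 1) * b.
Proof.
rewrite /pairing mulr_suml -sumrB; apply: eq_bigr => p _.
by rewrite mulr1 mulrBr.
Qed.

(** In the group algebra, E (g h) is within bounded l^1-distance of
    (E g) h + E h; the l^1-norm is expressed by duality with bounded
    functions. *)
Definition quasi_cocycle (E : G -> seq (R * G)) : Prop :=
  exists C : R, forall g h f (M : R), (forall z, `|f z| <= M) ->
    `|pairing (E g) (fun z => f (z * h)%g) + pairing (E h) f
      - pairing (E (g * h)%g) f| <= C * M.

(** The primitive of delta phi u a is phi u a + delta eta, where
    eta(g_1, ..., g_k) pairs E(g_1) with z |-> a(z, g_2, ..., g_k).  Evaluating
    it with the cocycle relation of a leaves precisely the defect of E, which is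
    bounded.  As eta needs a first argument, the degree of alpha has to be
    positive. *)
Lemma cup_eq0_of_quasi_cocycle (phi : G -> R) (E : G -> seq (R * G)) :
  (forall g, phi g = pairing (E g) (fun=> 1)) -> quasi_cocycle E ->
  forall (phi_qm : quasimorphism phi) k (alpha : Hb R G k), (0 < k)%N ->
  cup (Hb_class (qm_cocycle phi_qm)) alpha = 0.
Proof.
move=> phiE [C EC] phi_qm k alpha; case: k alpha => // k alpha _.
have -> : alpha = Hb_class (repr alpha) by rewrite /Hb_class reprK.
set a := repr alpha; have [[M aM] da] := bcocycleP a.
rewrite cupE; apply/Hb_class_eq0 => /=.
pose al (u : nat -> G) : R := on_nat (bcocycle_val a) u.
have alM u : `|al u| <= M by exact: aM.
pose eta : cochain R G k.+1 := fun g =>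
  pairing (E (g ord0))
    (fun z => bcocycle_val a (fun i => if i == ord0 then z else g i)).
have etaE u : on_nat eta u = pairing (E (u 0%N)) (fun z => al (with_head z u)).
  rewrite /on_nat /eta; congr pairing; apply/funext => z; congr (bcocycle_val a _).
  by apply/funext => -[[|i] ?].
pose f u z := al (with_head z (face 1 u)).
(* The faces of index at least 2 keep the added head z, and the faces of index
   0 and 1 give the right-hand side: this is the cocycle relation of a. *)
have al_coc u z : \sum_(j < k.+1) (-1) ^+ j.+2 * al (with_head z (face j.+2 u))
    = f u (z * u 1%N)%g - al (face 0 u).
  have := delta_faces (bcocycle_val a) (with_head z u).
  rewrite da {1}/on_nat -[X in X = _]/(0 : R) 2!big_ord_recl /= /bump /= add1n.
  rewrite expr0 expr1 mul1r mulN1r.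
  have -> : on_nat (bcocycle_val a) (face 0 (with_head z u)) = al (face 0 u).
    by apply: on_nat_ext => i.
  have -> : on_nat (bcocycle_val a) (face 1 (with_head z u)) = f u (z * u 1%N)%g.
    by apply: on_nat_ext => -[|[|i]].
  under [in RHS]eq_bigr => j _ do rewrite !add1n.
  have -> : \sum_(j < k.+1) (-1) ^+ j.+2 *
      on_nat (bcocycle_val a) (face j.+2 (with_head z u)) =
    \sum_(j < k.+1) (-1) ^+ j.+2 * al (with_head z (face j.+2 u)).
    apply: eq_bigr => j _; congr (_ * _); apply: on_nat_ext => -[|[|i]] //.
  by move=> /esym /eqP; rewrite addrA addr_eq0 => /eqP; lra.
have eta_delta u : on_nat (delta eta) u =
    pairing (E (u 0%N)) (fun z => f u (z * u 1%N)%g) + pairing (E (u 1%N)) (f u)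
    - pairing (E (u 0%N * u 1%N)%g) (f u) - phi (u 0%N) * al (face 0 u).
  rewrite delta_faces 2!big_ord_recl /= /bump /= add1n expr0 expr1 mul1r mulN1r.
  rewrite !etaE.
  under eq_bigr => j _ do rewrite !add1n etaE.
  have -> : (fun z => al (with_head z (face 0 u))) = f u.
    by apply/funext => z; apply: on_nat_ext => -[|i].
  have -> : \sum_(j < k.+1) (-1) ^+ j.+2 * pairing (E (face j.+2 u 0%N))
      (fun z => al (with_head z (face j.+2 u))) =
    pairing (E (u 0%N)) (fun z => f u (z * u 1%N)%g - al (face 0 u)).
    transitivity (pairing (E (u 0%N)) (fun z =>
        \sum_(j < k.+1) (-1) ^+ j.+2 * al (with_head z (face j.+2 u)))).
      by rewrite pairing_sum.
    by congr pairing; apply/funext => z; apply: al_coc.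
  by rewrite pairingB phiE /face /=; ring.
have betaE u : on_nat (cup_cochain (cochain1 phi) (bcocycle_val a)) u =
    phi (u 0%N) * al (face 0 u) by [].
exists (cup_cochain (cochain1 phi) (bcocycle_val a) - (- delta eta)).
  exists (C * M) => g; have [u ->] := on_nat_surj g.
  rewrite -[X in X <= _]/(`|on_nat (cup_cochain (cochain1 phi) (bcocycle_val a)) u
    + - - on_nat (delta eta) u|).
  rewrite opprK betaE eta_delta addrC subrK.
  by apply: EC => z; apply: alM.
apply/funext => g; rewrite deltaB -[- delta eta]sub0r deltaB delta0 delta_delta.
rewrite !subr0.
rewrite delta_cup da mulr0 addr0 /cup_cochain.
congr (_ * _); [congr (delta _ _)|congr (bcocycle_val a _)];
  apply/funext => i; congr g; apply: val_inj => //=.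
Qed.

End Criterion.

(** * Weighted windows of words *)

Section Words.
Variables (R : realType) (G : groupType) (A : Type).
Variables (ev : A -> G) (iv : A -> A).
Hypothesis ev_iv : forall a, ev (iv a) = (ev a)^-1%g.
Implicit Types (s t : seq A) (f : G -> R).

Definition value s : G := (\prod_(a <- s) ev a)%g.

Definition winv s : seq A := rev (map iv s).

Lemma value_cat s t : value (s ++ t) = (value s * value t)%g.
Proof. exact: big_cat. Qed.

Lemma value_cons a s : value (a :: s) = (ev a * value s)%g.
Proof. exact: big_cons. Qed.

Lemma value_nil : value [::] = 1%g.
Proof. exact: big_nil. Qed.

Lemma winv_cons a s : winv (a :: s) = winv s ++ [:: iv a].
Proof. by rewrite /winv /= rev_cons cats1. Qed.

Lemma winv_cat s t : winv (s ++ t) = winv t ++ winv s.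
Proof. by rewrite /winv map_cat rev_cat. Qed.

Lemma size_winv s : size (winv s) = size s.
Proof. by rewrite size_rev size_map. Qed.

Lemma value_winv s : value (winv s) = (value s)^-1%g.
Proof.
elim: s => [|a s IHs]; first by rewrite value_nil invg1.
by rewrite winv_cons value_cat IHs !value_cons value_nil mulg1 ev_iv invgM.
Qed.

Lemma winvK : involutive iv -> involutive winv.
Proof.
move=> ivK s.
rewrite /winv map_rev revK -map_comp -[RHS]map_id.
by apply: eq_map => a; apply: ivK.
Qed.

Variables (l : nat) (lam : seq A -> R).
Hypothesis l_gt0 : (0 < l)%N.

(** Both endpoints of a window count with the coefficient 1/2: this is what makes
    a window and its inverse cancel in [window_sum_winv]. *)
Definition window_sum s f : R :=
  \sum_(i < (size s).+1 - l) lam (take l (drop i s)) / 2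
     * (f (value (drop i s)) + f (value (drop (i + l) s))).

Definition window_chain s : seq (R * G) :=
  flatten [seq [:: (lam (take l (drop i s)) / 2, value (drop i s));
                   (lam (take l (drop i s)) / 2, value (drop (i + l) s))]
          | i <- iota 0 ((size s).+1 - l)].

Lemma pairing_window_chain s f : pairing (window_chain s) f = window_sum s f.
Proof.
rewrite /pairing /window_chain big_flatten /= big_map /window_sum.
rewrite -[X in iota _ X](subn0 ((size s).+1 - l)%N) big_mkord.
by apply: eq_bigr => i _; rewrite !big_cons big_nil /= addr0 mulrDr.
Qed.

Lemma window_sum_cons a s f :
  window_sum (a :: s) f =
    (if (l <= (size s).+1)%N
     then lam (take l (a :: s)) / 2
          * (f (value (a :: s)) + f (value (drop l (a :: s)))) else 0)
    + window_sum s f.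
Proof.
rewrite /window_sum [size (a :: s)]/=; case: ifP => [ls|/negbT ls].
  by rewrite subSn // big_ord_recl.
have -> : ((size s).+2 - l = 0)%N by lia.
have -> : ((size s).+1 - l = 0)%N by lia.
by rewrite !big_ord0 addr0.
Qed.

Lemma window_sum_nil f : window_sum [::] f = 0.
Proof.
rewrite /window_sum /=; have -> : (1 - l = 0)%N by lia.
by rewrite big_ord0.
Qed.

Variable L : R.
Hypothesis lam_le : forall s, `|lam s| <= L.

Lemma window_term_le s x y M : `|x| <= M -> `|y| <= M ->
  `|lam s / 2 * (x + y)| <= L * M.
Proof.
move=> xM yM; have -> : lam s / 2 * (x + y) = lam s * ((x + y) / 2) by ring.
rewrite normrM ler_pM // normrM [X in _ * X]ger0_norm ?invr_ge0 //.
rewrite ler_pdivrMr // (le_trans (ler_normD _ _)) //; lra.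
Qed.

Lemma window_sum_le s f (M : R) : (forall z, `|f z| <= M) ->
  `|window_sum s f| <= (size s)%:R * (L * M).
Proof.
move=> fM; have LM0 : 0 <= L * M.
  by rewrite mulr_ge0 // ?(le_trans _ (lam_le [::])) ?(le_trans _ (fM 1%g)).
elim: s => [|a s IHs]; first by rewrite window_sum_nil normr0 mul0r.
rewrite window_sum_cons (le_trans (ler_normD _ _)) //=.
rewrite -[(size s).+1%:R]natr1 mulrDl mul1r.
rewrite addrC lerD //; case: ifP => _; last by rewrite normr0.
exact: window_term_le.
Qed.

(** Every window of s or of t is one of s ++ t, with the same endpoints once those
    of s are multiplied by the value of t; fewer than l windows straddle the
    junction. *)
Lemma window_sum_cat s t f (M : R) : (forall z, `|f z| <= M) ->
  `|window_sum (s ++ t) f - window_sum s (fun z => f (z * value t)%g)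
    - window_sum t f| <= l%:R * (L * M).
Proof.
move=> fM; have LM0 : 0 <= L * M.
  by rewrite mulr_ge0 // ?(le_trans _ (lam_le [::])) ?(le_trans _ (fM 1%g)).
apply: (@le_trans _ _ ((minn (size s) l)%:R * (L * M))); last first.
  by rewrite ler_wpM2r // ler_nat geq_minr.
elim: s => [|a s IHs] /=.
  by rewrite window_sum_nil subr0 subrr normr0 mulr_ge0.
rewrite !window_sum_cons size_cat.
case: (leqP l (size s).+1) => ls.
  rewrite (leq_trans ls) ?ltnS ?leq_addr //.
  have -> : take l (a :: s ++ t) = take l (a :: s).
    by rewrite -[a :: s ++ t]/((a :: s) ++ t) takel_cat.
  have -> : value (a :: s ++ t) = (value (a :: s) * value t)%g.
    exact: (value_cat (a :: s)).
  have -> : value (drop l (a :: s ++ t)) = (value (drop l (a :: s)) * value t)%g.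
    rewrite -[a :: s ++ t]/((a :: s) ++ t) drop_cat [size (a :: s)]/=.
    case: ltngtP ls => // [_ _|e _]; first by rewrite value_cat.
    by rewrite e subnn drop0 drop_oversize // value_nil mul1g.
  (* The first window lies inside a :: s and contributes x on both sides. *)
  set x := _ / 2 * _; set y := window_sum (s ++ t) f.
  have := IHs; rewrite -/y; set u := window_sum s _; set v := window_sum t f.
  have -> : x + y - (x + u) - v = y - u - v by ring.
  move=> /le_trans; apply; rewrite ler_wpM2r // ler_nat; lia.
(* The first window, if there is one, reaches into t. *)
have /minn_idPl lE : (size s <= l)%N by lia.
rewrite add0r; rewrite lE in IHs.
move: IHs; set y := window_sum (s ++ t) f; set u := window_sum s _.
set v := window_sum t f => IHs.
case: ifP => _; last first.
  by rewrite add0r (le_trans IHs) // ler_wpM2r // ler_nat.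
set x := _ / 2 * _; have -> : x + y - u - v = (y - u - v) + x by ring.
rewrite (le_trans (ler_normD _ _)) //.
rewrite -[(size s).+1%:R]natr1 mulrDl mul1r lerD //.
exact: window_term_le.
Qed.

Lemma window_sum_cat3 s t r f (M : R) : (forall z, `|f z| <= M) ->
  `|window_sum (s ++ t ++ r) f
    - window_sum s (fun z => f (z * (value t * value r))%g)
    - window_sum r f| <= (size t + l + l)%:R * (L * M).
Proof.
move=> fM.
have := window_sum_cat s (t ++ r) fM; rewrite value_cat.
have := window_sum_cat t r fM.
have := @window_sum_le t (fun z => f (z * value r)%g) M (fun=> fM _).
rewrite !natrD; set x := L * M.
move: (window_sum (s ++ _) _) (window_sum s _) (window_sum (t ++ _) _) => p q u.
move: (window_sum r _) (window_sum t _) => v w.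
rewrite !ler_norml => /andP[] ? ? /andP[] ? ? /andP[] ? ?.
by apply/andP; split; lra.
Qed.

Hypothesis lam_winv : forall s, lam (winv s) = - lam s.

Lemma drop_winv i s : drop i (winv s) = winv (take (size s - i) s).
Proof. by rewrite /winv drop_rev size_map map_take. Qed.

Lemma take_winv i s : take i (winv s) = winv (drop (size s - i) s).
Proof. by rewrite /winv take_rev size_map map_drop. Qed.

(** A window of s read in the inverse word has the opposite weight and the same
    two endpoints up to right multiplication by the value of s, in the other
    order; the sum over both endpoints does not see that exchange. *)
Lemma window_sum_winv s f :
  window_sum (winv s) f = - window_sum s (fun z => f (z * (value s)^-1)%g).
Proof.
have cancel i : (value (drop i s) * (value s)^-1)%g = (value (take i s))^-1%g.
  by rewrite -{2}(cat_take_drop i s) value_cat invgM mulVKg.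
rewrite /window_sum size_winv (reindex_inj rev_ord_inj) -sumrN /=.
apply: eq_bigr => i _; rewrite !drop_winv take_winv !value_winv lam_winv.
have il := ltn_ord i.
have -> : (size s - ((size s).+1 - l - i.+1) = i + l)%N by lia.
have -> : (size s - ((size s).+1 - l - i.+1 + l) = i)%N by lia.
rewrite !cancel size_takel; last by lia.
rewrite addnK -{1}[(i + l)%N]addnC -take_drop; ring.
Qed.

End Words.

Section Triangles.
Variables (R : realType) (G : groupType) (A : Type).
Variables (ev : A -> G) (iv : A -> A).
Hypothesis ev_iv : forall a, ev (iv a) = (ev a)^-1%g.
Variable D : G -> seq A.

(** The words of g, h and g h follow a tripod with branches c1, c2 and c3, up to a
    bounded piece at its centre. *)
Definition thin_triangles : Prop :=
  exists C : nat, forall g h, exists c1 c2 c3 r1 r2 r3,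
    [/\ D g = c1 ++ r1 ++ c2, D h = winv iv c2 ++ r2 ++ c3,
        D (g * h)%g = c1 ++ r3 ++ c3
      & [/\ size r1 <= C, size r2 <= C & size r3 <= C]%N].

Hypothesis value_D : forall g, value ev (D g) = g.
Hypothesis D_thin : thin_triangles.

(** The weighted endpoints of the windows of D g form a quasi-cocycle: the
    branches c1 and c3 of the tripod contribute equally to the two sides, and the
    contributions of c2 in D g and of its inverse in D h cancel. *)
Lemma cup_eq0_of_windows (l : nat) (lam : seq A -> R) (phi : G -> R) :
  (0 < l)%N -> (exists L, forall s, `|lam s| <= L) ->
  (forall s, lam (winv iv s) = - lam s) ->
  (forall g, phi g = \sum_(i < (size (D g)).+1 - l) lam (take l (drop i (D g)))) ->
  forall (phi_qm : quasimorphism phi) k (alpha : Hb R G k), (0 < k)%N ->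
  cup (Hb_class (qm_cocycle phi_qm)) alpha = 0.
Proof.
move=> l_gt0 [L lamL] lam_inv phiE.
apply: (@cup_eq0_of_quasi_cocycle _ _ phi (fun g => window_chain ev l lam (D g))).
  move=> g; rewrite pairing_window_chain phiE; apply: eq_bigr => i _.
  by field.
have [C DC] := D_thin; exists (3 * ((C + l + l)%:R * L)) => g h f M fM.
have LM0 : 0 <= L * M.
  by rewrite mulr_ge0 // ?(le_trans _ (lamL [::])) ?(le_trans _ (fM 1%g)).
rewrite !pairing_window_chain.
have [c1 [c2 [c3 [r1 [r2 [r3 [Dg Dh Dgh [r1C r2C r3C]]]]]]]] := DC g h.
have gE := value_D g; have hE := value_D h; have ghE := value_D (g * h)%g.
rewrite Dg !value_cat in gE; rewrite Dh !value_cat value_winv // in hE.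
rewrite Dgh !value_cat in ghE.
have fhM z : `|f (z * h)%g| <= M by [].
have cat3 s t r f' : (forall z, `|f' z| <= M) -> (size t <= C)%N ->
    `|window_sum ev l lam (s ++ t ++ r) f'
      - window_sum ev l lam s (fun z => f' (z * (value ev t * value ev r))%g)
      - window_sum ev l lam r f'| <= (C + l + l)%:R * (L * M).
  move=> f'M tC; apply: (le_trans (window_sum_cat3 _ _ _ _ _ _ f'M)) => //.
  by rewrite ler_wpM2r // ler_nat; lia.
have := cat3 c1 r1 c2 _ fhM r1C; have := cat3 c1 r3 c3 _ fM r3C.
have := cat3 (winv iv c2) r2 c3 _ fM r2C.
rewrite -Dg -Dh -Dgh window_sum_winv //.
(* The endpoints along c2 are the same seen from D g as seen from D h. *)
have -> : (fun z => f (z * (value ev c2)^-1 * (value ev r2 * value ev c3))%g) =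
    (fun z => f (z * h)%g).
  by apply/funext => z; rewrite -mulgA hE.
(* The endpoints along c1 are the same seen from D g as seen from D (g * h). *)
have -> : (fun z => f (z * (value ev r1 * value ev c2) * h)%g) =
    (fun z => f (z * (value ev r3 * value ev c3))%g).
  apply/funext => z; rewrite -mulgA; congr (f (_ * _)%g).
  by apply: (mulgI (value ev c1)); rewrite ghE mulgA gE.
move: (window_sum _ _ _ (D g) _) (window_sum _ _ _ (D h) _) => p q.
move: (window_sum _ _ _ (D (g * h)%g) _) (window_sum _ _ _ c1 _) => r x.
move: (window_sum _ _ _ c2 _) (window_sum _ _ _ c3 _) => y z.
rewrite -!mulrA; move: (_%:R * (L * M)) => K.
rewrite !ler_norml => /andP[] ? ? /andP[] ? ? /andP[] ? ?.
by apply/andP; split; lra.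
Qed.

Lemma cup_eq0_of_letters (mu : A -> R) (phi : G -> R) :
  (exists L, forall a, `|mu a| <= L) -> (forall a, mu (iv a) = - mu a) ->
  (forall g, phi g = \sum_(a <- D g) mu a) ->
  forall (phi_qm : quasimorphism phi) k (alpha : Hb R G k), (0 < k)%N ->
  cup (Hb_class (qm_cocycle phi_qm)) alpha = 0.
Proof.
move=> [L muL] muV phiE.
pose lam s := if s is [:: a] then mu a else 0.
apply: (@cup_eq0_of_windows 1 lam) => //.
- exists `|L| => -[|a [|b s]] /=; rewrite ?normr0 //.
  exact: le_trans (muL a) (ler_norm L).
- move=> [|a [|b s]]; [by rewrite /lam oppr0|exact: muV|].
  rewrite /lam oppr0 /winv; case: rev (size_rev (map iv [:: a, b & s])) => //=.
  by move=> c [|d t].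
- move=> g; rewrite phiE subn1 /=; elim: (D g) => [|a s IHs].
    by rewrite big_nil big_ord0.
  by rewrite big_cons big_ord_recl IHs /= take0.
Qed.

End Triangles.

(** * Maximal cancellation between words *)

Section Cancellation.
Variables (A : eqType) (iv : A -> A).

Lemma max_cancellation (s t : seq A) : exists s' c t',
  [/\ s = s' ++ c, t = winv iv c ++ t'
    & forall s'' d t'', s = s'' ++ d -> t = winv iv d ++ t'' ->
        (size d <= size c)%N].
Proof.
pose P k := `[< exists s' c t',
  [/\ s = s' ++ c, t = winv iv c ++ t' & size c = k] >].
have P0 : exists k, P k.
  by exists 0%N; apply/asboolP; exists s, [::], t; rewrite cats0.
have Ple k : P k -> (k <= size s)%N.
  by move=> /asboolP[s' [c [t' [-> _ <-]]]]; rewrite size_cat leq_addl.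
case: (ex_maxnP P0 Ple) => k /asboolP[s' [c [t' [sE tE cE]]]] kmax.
exists s', c, t'; split=> // s'' d t'' sE' tE'; rewrite cE.
by apply: kmax; apply/asboolP; exists s'', d, t''.
Qed.

(** If the letters at the junction were inverse to each other, the cancelled part
    could be extended. *)
Lemma max_cancellation_junction (s t : seq A) : exists s' c t',
  [/\ s = s' ++ c, t = winv iv c ++ t'
    & forall s0 a t0, s' = rcons s0 a -> t' = iv a :: t0 -> False].
Proof.
have [s' [c [t' [sE tE cmax]]]] := max_cancellation s t.
exists s', c, t'; split=> // s0 a t0 s'E t'E.
have := cmax s0 (a :: c) t0; rewrite sE tE s'E t'E cat_rcons winv_cons -catA.
by move=> /(_ erefl erefl) /=; rewrite ltnn.
Qed.

Lemma sorted_cat_junction (e : rel A) s t : sorted e s -> sorted e t ->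
  (forall s0 a b t0, s = rcons s0 a -> t = b :: t0 -> e a b) ->
  sorted e (s ++ t).
Proof.
case: s => [//|x s] /=; rewrite cat_path => -> /=.
case: t => [//|b t] /= -> junction; rewrite andbT.
by apply: (junction (belast x s) _ b t); rewrite // lastI.
Qed.

End Cancellation.

(** * Reduced words and Brooks quasimorphisms *)

Section FreeGroup.
Variables (F : groupType) (B : set F).
Hypothesis B_free : free_generating_set B.

Lemma rwordP g : reduced_word B (rword B g) /\ (\prod_(a <- rword B g) a)%g = g.
Proof.
have [s [sP _]] := B_free.2 g.
by rewrite /rword; case: xgetP => [_ _ //|/(_ s)].
Qed.

Lemma reduced_rword s : reduced_word B s -> rword B (\prod_(a <- s) a)%g = s.
Proof.
move=> sP; have [t [_ tU]] := B_free.2 (\prod_(a <- s) a)%g.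
by rewrite -(tU _ (rwordP _)); apply: tU.
Qed.

Lemma rword1 : rword B 1%g = [::].
Proof. by rewrite -[1%g](big_nil 1%g *%g xpredT id) reduced_rword. Qed.

(** The letters b and b^-1 are distinct, by the first clause of
    [free_generating_set]. *)
Lemma symmetrization_neqV a : symmetrization B a -> a != a^-1%g.
Proof.
move=> aB; apply/eqP => aV; case: aB => [Ba|[b Bb bV]].
  by apply: (B_free.1 _ Ba); rewrite -aV.
apply: (B_free.1 _ Bb); rewrite bV.
by have <- : b = a by apply: invg_inj; rewrite bV.
Qed.

(** After a maximal cancellation the remaining word is reduced, hence it is the
    reduced word of the product: triangles of reduced words are exact tripods. *)
Lemma rword_mul g h : exists c1 c2 c3,
  [/\ rword B g = c1 ++ c2, rword B h = winv (fun a : F => a^-1%g) c2 ++ c3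
    & rword B (g * h)%g = c1 ++ c3].
Proof.
have [c1 [c2 [c3 [gE hE junction]]]] :=
  max_cancellation_junction (fun a : F => a^-1%g) (rword B g) (rword B h).
exists c1, c2, c3; split=> //.
have [[gB gS] gP] := rwordP g; have [[hB hS] hP] := rwordP h.
have <- : (\prod_(a <- c1 ++ c3) a = g * h)%g.
  rewrite -gP -hP gE hE.
  have v s : (\prod_(a <- s) a)%g = value id s by [].
  by rewrite !v !value_cat value_winv // -mulgA mulVKg.
apply: reduced_rword; split.
  move=> a; rewrite mem_cat => /orP[] ac; [apply: gB; rewrite gE|].
    by rewrite mem_cat ac.
  by apply: hB; rewrite hE mem_cat ac orbT.
apply: sorted_cat_junction.
- by move: gS; rewrite gE => /cat_sorted2[].
- by move: hS; rewrite hE => /cat_sorted2[].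
- move=> s0 a b t0 c1E c3E; apply/eqP => ab1; apply: (junction s0 a t0) => //.
  by rewrite c3E; congr (_ :: _); rewrite -[RHS]mulg1 -ab1 mulKg.
Qed.

(** There is no element of order 2.  If w = w^-1, the reduced word of w equals its
    own inverse; then its middle letter is its own inverse, or its two middle
    letters cancel, depending on the parity of its length.  This makes
    [brooks_chi] alternating. *)
Lemma free_neqV (w : F) : w != 1%g -> w != w^-1%g.
Proof.
move=> w1; apply: contraNneq w1 => wV.
have [[wB wS] wP] := rwordP w.
(* In w * w = 1 everything cancels, so the reduced word of w is c2 = c2^-1. *)
have [c1 [c2 [c3 []]]] := rword_mul w w.
have -> : (w * w = 1)%g by rewrite {2}wV mulgV.
rewrite rword1; case: c1 => //; case: c3 => //= wE.
rewrite cats0 -wE => wE' _.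
rewrite -wP; case: (posnP (size (rword B w))) => [/size0nil ->|n_gt0].
  by rewrite big_nil.
set s := rword B w in n_gt0 wE' *; set n := size s in n_gt0.
have sE i : (i < n)%N -> nth 1%g s i = (nth 1%g s (n.-1 - i))^-1%g.
  move=> i_n; rewrite {1}wE' nth_rev size_map // (nth_map 1%g);
    last by rewrite -/n; lia.
  by congr ((nth _ _ _)^-1%g); rewrite -/n; lia.
have nE := odd_double_half n.
case: (boolP (odd n)) => n_odd; rewrite ?n_odd ?(negbTE n_odd) in nE.
  have k_n : (n./2 < n)%N by lia.
  have /symmetrization_neqV/eqP[] := wB _ (mem_nth 1%g k_n).
  by rewrite -/s {1}sE //; have -> : (n.-1 - n./2 = n./2)%N by lia.
have /(sortedP 1%g)/(_ (n./2).-1) := wS; rewrite -/s -/n.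
have -> : ((n./2).-1.+1 = n./2)%N by lia.
rewrite (sE (n./2)); last by lia.
have -> : (n.-1 - n./2 = (n./2).-1)%N by lia.
by rewrite mulgV eqxx => /(_ ltac:(lia)).
Qed.

End FreeGroup.

Section Brooks.
Variables (R : realType) (F : groupType) (B : set F).
Hypothesis B_free : free_generating_set B.

Lemma cup_brooks_eq0 (phi : F -> R) : is_brooks B phi ->
  forall (phi_qm : quasimorphism phi) k (alpha : Hb R F k), (0 < k)%N ->
  cup (Hb_class (qm_cocycle phi_qm)) alpha = 0.
Proof.
move=> [w w1 phiE].
apply: (@cup_eq0_of_windows _ _ _ id (fun a : F => a^-1%g) _ (rword B) _ _
  (size (rword B w)) (fun s => (brooks_chi w (value id s))%:~R)) => //.
- by move=> g; have [] := rwordP B_free g.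
- exists 0%N => g h; have [c1 [c2 [c3 [-> -> ->]]]] := rword_mul B_free g h.
  by exists c1, c2, c3, [::], [::], [::].
- rewrite lt0n; apply: contraNneq w1 => /size0nil wE.
  by have [_ <-] := rwordP B_free w; rewrite wE big_nil.
- exists 1 => s; rewrite /brooks_chi; case: ifP => _; first by rewrite normr1.
  by case: ifP => _; rewrite ?mulrN1z ?normrN ?normr1 ?normr0.
- move=> s; rewrite value_winv // -mulrNz; congr (_%:~R); rewrite /brooks_chi.
  rewrite eqg_inv eqg_invLR.
  have := free_neqV B_free w1.
  case: (value id s =P w) => [->|] wV; first by rewrite (negbTE wV).
  by case: ifP.
- by move=> g; rewrite phiE /brooks mulrz_sumr.
Qed.

End Brooks.

(** * Decompositions into pieces *)

Section Decomposition.
Variables (F : groupType) (B P : set F) (Delta : F -> seq F).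
Hypothesis B_free : free_generating_set B.
Hypothesis dec : delta_decomposition B P Delta.

Local Notation inv := (fun a : F => a^-1%g).

Lemma value_Delta g : value id (Delta g) = g.
Proof.
rewrite -[RHS](rwordP B_free g).2 (delta_reduced dec g).
rewrite big_flatten /= big_map; apply: eq_bigr => p _.
by have [_ ->] := rwordP B_free p.
Qed.

(** A piece in the decomposition of 1 would have an empty reduced word. *)
Lemma Delta1 : Delta 1%g = [::].
Proof.
have := delta_reduced dec 1%g; rewrite (rword1 B_free).
case E : (Delta 1%g) => [//|p s] /=.
case pE : (rword B p) => // _; case: (pieces_neq1 dec).
have pP : p \in Delta 1%g by rewrite E mem_head.
have [_ p1] := rwordP B_free p; move: p1; rewrite pE big_nil => ->.
exact: delta_pieces dec _ _ pP.
Qed.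

Lemma Delta_value g s1 s s2 : Delta g = s1 ++ s ++ s2 -> Delta (value id s) = s.
Proof.
case: (s =P [::]) => [->|/eqP s0] gE; first by rewrite value_nil Delta1.
exact: delta_infix dec _ _ _ _ gE s0.
Qed.

Lemma Delta_winv g : Delta g^-1%g = winv inv (Delta g).
Proof. exact: delta_inv dec g. Qed.

Let winvK : involutive (winv inv).
Proof. by apply: winvK; apply: invgK. Qed.

(** The decomposition of p^-1 p = 1 is empty, so these two pieces cannot be
    consecutive. *)
Lemma Delta_no_cancel g s1 p s2 : Delta g <> s1 ++ p^-1%g :: p :: s2.
Proof.
move=> gE; have := @Delta_value g s1 [:: p^-1%g; p] s2 gE.
by rewrite !value_cons value_nil mulg1 mulVg Delta1.
Qed.

(** Let c1 be a common prefix of Delta g and Delta (g h), and let c2 be a suffix of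
    Delta g that Delta h begins by inverting.  If a piece p of Delta g belonged to
    both, then Delta h would continue with p^-1 followed by the decomposition t of
    what remains, where t represents the same element as the part of Delta (g h)
    that starts with p.  So t starts with p, against [Delta_no_cancel]. *)
Lemma shared_pieces_disjoint g h c1 x y c2 z v :
  Delta g = c1 ++ x -> Delta (g * h)%g = c1 ++ z ->
  Delta g = y ++ c2 -> Delta h = winv inv c2 ++ v ->
  (size c1 + size c2 <= size (Delta g))%N.
Proof.
case/lastP: c1 => [|u p] gE ghE gE' hE.
  by rewrite gE' size_cat leq_addl.
rewrite leqNgt; apply/negP; rewrite {1}gE' size_cat ltn_add2r size_rcons ltnS => yu.
have [c0 c2E] : exists c0, c2 = c0 ++ p :: x.
  exists (drop (size y) u).
  have := congr1 (drop (size y)) gE'; rewrite drop_size_cat // => <-.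
  by rewrite gE cat_rcons drop_cat ltn_neqAle yu; case: eqP => //= ->;
     rewrite subnn drop0 drop_size.
rewrite c2E winv_cat winv_cons -!catA /= in hE.
move: (winv inv c0 ++ v) hE => t hE.
have tE : value id t = value id (p :: z).
  apply: (mulgI (value id u)).
  rewrite -[RHS]value_cat -cat_rcons -ghE value_Delta.
  rewrite -[g in RHS]value_Delta -[h in RHS]value_Delta.
  rewrite gE hE cat_rcons !value_cat !value_cons value_winv //.
  by rewrite !mulgA !mulgK.
have zE : Delta (value id (p :: z)) = p :: z.
  by apply: (@Delta_value (g * h)%g u _ [::]); rewrite cats0 -cat_rcons.
have tz : t = p :: z.
  rewrite -zE -tE; symmetry.
  by apply: (@Delta_value h (winv inv x ++ [:: p^-1%g]) _ [::]); rewrite cats0 -catA.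
by move: hE; rewrite tz; apply: Delta_no_cancel.
Qed.

Lemma cat_overlap (a x y c : seq F) : a ++ x = y ++ c ->
  (size a + size c <= size (a ++ x))%N -> exists r, a ++ x = a ++ r ++ c.
Proof.
move=> E; rewrite {1}E size_cat leq_add2r => ay.
exists (drop (size a) y).
have := congr1 (take (size a)) E; rewrite take_size_cat // takel_cat // => aE.
by rewrite E catA; congr (_ ++ _); rewrite -{1}(cat_take_drop (size a) y) -aE.
Qed.

(** Each branch is taken maximal for itself; by [shared_pieces_disjoint], applied
    to each of the three sides, the branches do not overlap, so they form a
    common three-part expression. *)
Lemma exists_maximal_three_part g h : exists c1 c2 c3 r1 r2 r3,
  maximal_three_part Delta g h c1 c2 c3 r1 r2 r3.
Proof.
have [x1 [d1 [y1 [gV1 gh1 max1]]]] :=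
  max_cancellation inv (Delta g^-1%g) (Delta (g * h)%g).
have [x2 [d2 [y2 [g2 h2 max2]]]] :=
  max_cancellation inv (Delta g) (Delta h).
have [x3 [d3 [y3 [gh3 hV3 max3]]]] :=
  max_cancellation inv (Delta (g * h)%g) (Delta h^-1%g).
have g1 : Delta g = winv inv d1 ++ winv inv x1.
  by rewrite -winv_cat -gV1 -Delta_winv invgK.
have h3 : Delta h = winv inv y3 ++ d3.
  by rewrite -[d3]winvK -winv_cat -hV3 -Delta_winv invgK.
have [R1 gE] : exists R1, Delta g = winv inv d1 ++ R1 ++ d2.
  rewrite g1; apply: (@cat_overlap _ _ x2); first by rewrite -g1.
  by rewrite -g1; apply: (shared_pieces_disjoint g1 gh1 g2 h2).
have [R3 ghE] : exists R3, Delta (g * h)%g = winv inv d1 ++ R3 ++ d3.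
  rewrite gh1; apply: (@cat_overlap _ _ x3); first by rewrite -gh1.
  rewrite -gh1; apply: (shared_pieces_disjoint (h := h^-1%g) gh1 _ gh3 hV3).
  by rewrite mulgK; apply: g1.
have [R2 hE] : exists R2, Delta h = winv inv d2 ++ R2 ++ d3.
  rewrite h2; apply: (@cat_overlap _ _ (winv inv y3)); first by rewrite -h2.
  rewrite -h2 addnC size_winv -(size_winv inv d3) -(size_winv inv (Delta h)).
  rewrite -Delta_winv.
  apply: (shared_pieces_disjoint (h := g^-1%g) hV3 _ _ _).
  - by rewrite -invgM Delta_winv gh3 winv_cat.
  - by rewrite Delta_winv h2 winv_cat winvK.
  - by rewrite Delta_winv g2 winv_cat.
pose v := value (@id F).
have D1 : Delta (v d1) = d1.
  by apply: (@Delta_value g^-1%g x1 _ [::]); rewrite cats0.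
have D2 : Delta (v d2) = d2 by apply: (@Delta_value g x2 _ [::]); rewrite cats0.
have D3 : Delta (v d3) = d3.
  by apply: (@Delta_value (g * h)%g x3 _ [::]); rewrite cats0.
exists (v d1), (v d2), (v d3), (v R1), (v R2), (v R3)^-1%g; split.
  split; rewrite ?invgK ?Delta_winv ?D1 ?D2 ?D3.
  - by rewrite (Delta_value gE).
  - by rewrite (Delta_value hE).
  - by rewrite (Delta_value ghE).
move=> e1 e2 e3 t1 t2 t3 [ge he ghe]; rewrite D1 D2 D3; split.
- apply: (max1 (winv inv (Delta t1 ++ Delta e2)) _ (Delta t3^-1%g ++ Delta e3)).
    by rewrite Delta_winv ge winv_cat Delta_winv winvK.
  by rewrite ghe Delta_winv.
- apply: (max2 (Delta e1^-1%g ++ Delta t1) _ (Delta t2 ++ Delta e3)).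
    by rewrite ge catA.
  by rewrite he Delta_winv.
- apply: (max3 (Delta e1^-1%g ++ Delta t3^-1%g) _
    (winv inv (Delta e2^-1%g ++ Delta t2))).
    by rewrite ghe catA.
  by rewrite Delta_winv he catA winv_cat.
Qed.

Lemma Delta_thin_triangles : thin_triangles inv Delta.
Proof.
have [C _ DC] := delta_bounded dec; exists C => g h.
have [c1 [c2 [c3 [r1 [r2 [r3 mtp]]]]]] := exists_maximal_three_part g h.
have [[gE hE ghE] _] := mtp; have [r1C r2C r3C] := DC _ _ _ _ _ _ _ _ mtp.
exists (Delta c1^-1%g), (Delta c2), (Delta c3).
exists (Delta r1), (Delta r2), (Delta r3^-1%g).
by rewrite -Delta_winv; split=> //; rewrite (Delta_winv r3) size_winv.
Qed.

End Decomposition.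

(** The weight lambda is extended by 0 outside the pieces, so that it is bounded
    and alternating everywhere. *)
Lemma cup_decomposable_eq0 (R : realType) (F : groupType) (B : set F)
    (B_free : free_generating_set B) (phi : F -> R) : is_decomposable B phi ->
  forall (phi_qm : quasimorphism phi) k (alpha : Hb R F k), (0 < k)%N ->
  cup (Hb_class (qm_cocycle phi_qm)) alpha = 0.
Proof.
move=> [P [Delta [lambda [dec [M lamM] lamV phiE]]]].
have Psym p : `[< P p^-1%g >] = `[< P p >].
  by apply: asbool_equiv_eq; split=> /(pieces_sym dec); rewrite ?invgK.
apply: (@cup_eq0_of_letters _ _ _ id (fun a : F => a^-1%g) _ Delta _ _
  (fun p => if `[< P p >] then lambda p else 0)) => //.
- exact: value_Delta B_free dec.
- exact: Delta_thin_triangles B_free dec.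
- exists `|M| => p; case: asboolP => [Pp|_]; last by rewrite normr0.
  exact: le_trans (lamM _ Pp) (ler_norm M).
- move=> p; rewrite Psym; case: asboolP => [Pp|_]; last by rewrite oppr0.
  exact: lamV.
- move=> g; rewrite phiE big_seq [RHS]big_seq; apply: eq_bigr => p pg.
  by rewrite asboolT //; apply: (delta_pieces dec) pg.
Qed.

(** * Syllables and Rolli quasimorphisms *)

Section IntegerPowers.
Variable G : groupType.
Implicit Types (g : G) (m : int).

Lemma zpowN g m : zpow g (- m) = (zpow g m)^-1%g.
Proof. by case: m => [[|m]|m] /=; rewrite ?invg1 ?invgK. Qed.

Lemma zpowD1 g m : zpow g (m + 1) = (zpow g m * g)%g.
Proof.
case: m => [m|[|m]] /=; first by rewrite addn1 expgSr.
  by rewrite expg1 mulVg.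
by rewrite subn1 /= [in RHS]expgS invgM mulgVK.
Qed.

Lemma zpowD g m1 m2 : zpow g (m1 + m2) = (zpow g m1 * zpow g m2)%g.
Proof.
elim/int_ind: m2 => [|m2 IHm|m2 IHm]; first by rewrite addr0 mulg1.
  have -> : m2.+1%:Z = m2%:Z + 1 by lia.
  by rewrite addrA !zpowD1 IHm mulgA.
apply: (mulIg g); rewrite -mulgA -!zpowD1.
have E : - m2.+1%:Z + 1 = - m2%:Z by lia.
by rewrite -addrA E.
Qed.

End IntegerPowers.

Section Syllables.
Variables (F : groupType) (B : set F) (n : nat) (x : 'I_n -> F).
Hypothesis B_free : free_generating_set B.
Hypothesis x_inj : injective x.
Hypothesis BE : B = range x.
Implicit Types (p q : 'I_n * int) (t : seq ('I_n * int)).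

Definition syl_inv p : 'I_n * int := (p.1, - p.2).

Definition syl_value p : F := zpow (x p.1) p.2.

Definition syl_letter p : F := if 0 <= p.2 then x p.1 else (x p.1)^-1%g.

Definition spelling t : seq F :=
  flatten [seq nseq `|p.2|%N (syl_letter p) | p <- t].

Lemma syl_invK : involutive syl_inv.
Proof. by move=> [i m]; rewrite /syl_inv /= opprK. Qed.

Lemma syl_value_inv p : syl_value (syl_inv p) = (syl_value p)^-1%g.
Proof. exact: zpowN. Qed.

Lemma value_spelling t : value id (spelling t) = value syl_value t.
Proof.
rewrite /value /spelling big_flatten /= big_map; apply: eq_bigr => -[i m] _.
rewrite big_nseq /syl_value /syl_letter /=.
have iterE k (g : F) : iter k (fun y => g * y)%g 1%g = (g ^+ k)%g.
  by elim: k => //= k ->; rewrite expgS.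
by case: m => m /=; rewrite iterE // -expgS expVgn.
Qed.

Lemma generator_neqV i j : (x i * x j != 1)%g.
Proof.
apply/eqP => ij; apply: (B_free.1 (x j)); rewrite BE; first by exists j.
by exists i => //; rewrite -[LHS]mulg1 -(mulgV (x j)) mulgA ij mul1g.
Qed.

Lemma syl_letter_mul p q : (p.1 != q.1) || (syl_letter p == syl_letter q) ->
  (syl_letter p * syl_letter q != 1)%g.
Proof.
rewrite /syl_letter; case: p q => [i m] [j m'] /= ij.
have neqV : (x i != (x j)^-1)%g.
  by apply: contraNneq (generator_neqV i j) => ->; rewrite mulVg.
have eqE : (x i == x j) = (i == j) by rewrite (inj_eq x_inj).
have mulE (a b : F) : (a * b == 1)%g = (a == b^-1)%g.
  by rewrite -[RHS](inj_eq (mulIg b)) mulVg.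
move: ij; case: ifP => _; case: ifP => _; rewrite mulE ?invgK ?eqE //.
- by rewrite (negbTE neqV) orbF.
- by rewrite eqg_inv eqg_invLR (negbTE neqV) orbF eqE.
- by move=> _; rewrite eqg_invLR.
Qed.

Lemma spelling_reduced t : syllable_word t -> reduced_word B (spelling t).
Proof.
move=> [t0 tS]; split.
  move=> a /flatten_mapP[p pt]; rewrite mem_nseq => /andP[_ /eqP ->].
  rewrite /syl_letter BE; case: ifP => _; [left|right]; first by exists p.1.
  by exists (x p.1) => //; exists p.1.
elim: t t0 tS => [//|p t IHt] /= /andP[p0 t0] tS.
apply: sorted_cat_junction.
- case: `|p.2|%N => //= k; elim: k => //= k ->; rewrite andbT.
  by apply: syl_letter_mul; rewrite !eqxx.
- by apply: IHt => //; apply: path_sorted tS.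
- move=> s0 a b s1 pE tE.
  have : a \in nseq `|p.2|%N (syl_letter p) by rewrite pE mem_rcons mem_head.
  rewrite mem_nseq => /andP[_ /eqP ->]; case: t tE t0 tS {IHt} => //= q t.
  move=> tE /andP[q0 _] /andP[pq _]; move: tE; rewrite /spelling /=.
  case: `|q.2|%N (absz_eq0 q.2) => [|k _ [<- _]]; first by rewrite (negbTE q0).
  by apply: syl_letter_mul; rewrite pq.
Qed.

(** A non-empty syllable word spells a non-empty reduced word. *)
Lemma syllable_word_value1 t :
  syllable_word t -> value syl_value t = 1%g -> t = [::].
Proof.
move=> tP t1; have := reduced_rword B_free (spelling_reduced tP).
rewrite -/(value id _) value_spelling t1 rword1 //; case: t tP {t1} => // p t [].
move=> /= /andP[p0 _] _; rewrite /spelling /=.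
by case: `|p.2|%N (absz_eq0 p.2) p0 => [<-|].
Qed.

Lemma syllable_word_cat s t : syllable_word (s ++ t) <->
  [/\ syllable_word s, syllable_word t
    & forall s0 p q t0, s = rcons s0 p -> t = q :: t0 -> p.1 != q.1].
Proof.
rewrite /syllable_word all_cat; split.
  move=> [/andP[-> ->] stS]; have [-> ->] := cat_sorted2 stS; split=> //.
  move=> s0 p q t0 sE tE; move: stS; rewrite sE tE cat_rcons.
  by move=> /cat_sorted2[_ /= /andP[]].
move=> [[-> sS] [-> tS] st]; split=> //.
exact: sorted_cat_junction.
Qed.

(** After a maximal cancellation of syllables, the two syllables that meet, if any,
    either have different generators, and the product is already a syllable word,
    or they have the same generator and exponents that do not add up to 0, and
    they merge into one syllable. *)
Lemma syllable_word_mul t1 t2 : syllable_word t1 -> syllable_word t2 ->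
  exists c1 c2 c3 r1 r2 r3,
  [/\ t1 = c1 ++ r1 ++ c2, t2 = winv syl_inv c2 ++ r2 ++ c3,
      syllable_word (c1 ++ r3 ++ c3),
      (value syl_value (c1 ++ r3 ++ c3)
       = value syl_value t1 * value syl_value t2)%g
    & [/\ size r1 = size r3, size r2 = size r3 & (size r3 <= 1)%N]].
Proof.
move=> t1P t2P.
have [s1 [c2 [s2 [t1E t2E junction]]]] := max_cancellation_junction syl_inv t1 t2.
rewrite t1E in t1P; rewrite t2E in t2P.
have /syllable_word_cat[s1P _ _] := t1P; have /syllable_word_cat[_ s2P _] := t2P.
have valE : (value syl_value t1 * value syl_value t2
             = value syl_value s1 * value syl_value s2)%g.
  rewrite t1E t2E !value_cat (value_winv syl_value_inv).
  by rewrite -mulgA mulVKg.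
have separated : (forall u p q v, s1 = rcons u p -> s2 = q :: v -> p.1 != q.1) ->
    syllable_word (s1 ++ s2).
  by move=> sep; apply/syllable_word_cat.
case/lastP: s1 => [|u [i m]] in t1E t1P s1P junction valE separated *.
  exists [::], c2, s2, [::], [::], [::]; rewrite valE value_nil mul1g.
  by split=> //; apply: separated => -[].
case: s2 => [|[j m'] v] in t2E t2P s2P junction valE separated *.
  exists (rcons u (i, m)), c2, [::], [::], [::], [::].
  rewrite valE value_nil mulg1 cats0.
  by split=> //; rewrite ?cats0 // in separated *; apply: separated.
have [ij|ij] := eqVneq i j; last first.
  exists (rcons u (i, m)), c2, ((j, m') :: v), [::], [::], [::].
  rewrite valE value_cat; split=> //; apply: separated => ? p q ?.
  by move=> /rcons_inj[_ <-] [<- _].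
subst j; have mm' : m + m' != 0.
  apply: contra_notN (junction u (i, m) v erefl) => /eqP mm'.
  by congr ((_, _) :: _); apply/eqP; rewrite -addr_eq0 addrC mm'.
exists u, c2, v, [:: (i, m)], [:: (i, m')], [:: (i, m + m')].
rewrite valE; split=> //; first by rewrite t1E cat_rcons.
- move: s1P s2P; rewrite -cats1 -[_ :: v]cat1s.
  move=> /syllable_word_cat[uP _ uS] /syllable_word_cat[_ vP vS].
  apply/syllable_word_cat; split=> //.
    apply/syllable_word_cat; split=> //; first by split; rewrite //= mm'.
    by move=> [|? [|//]] p q w // [<-] vE; apply: (vS [::] (i, m') q w).
  by move=> w p q ? uE [<- _]; apply: (uS w p (i, m) [::]).
- rewrite -cats1 !value_cat !value_cons value_nil !mulg1.
  by rewrite /syl_value /= zpowD !mulgA.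
Qed.

Lemma syllable_word_winv t : syllable_word t -> syllable_word (winv syl_inv t).
Proof.
move=> [t0 tS]; split.
  by rewrite all_rev all_map; apply: sub_all t0 => p; rewrite /= oppr_eq0.
rewrite rev_sorted sorted_map; apply: sub_sorted tS => p q.
by rewrite /= eq_sym.
Qed.

(** In the product of t1 by the inverse of t2, a syllable word of value 1, hence
    empty, is left: everything has cancelled. *)
Lemma syllable_word_inj t1 t2 : syllable_word t1 -> syllable_word t2 ->
  value syl_value t1 = value syl_value t2 -> t1 = t2.
Proof.
move=> t1P t2P t12.
have [c1 [c2 [c3 [r1 [r2 [r3 [t1E t2E cP]]]]]]] :=
  syllable_word_mul t1P (syllable_word_winv t2P).
rewrite (value_winv syl_value_inv) t12 mulgV => /(syllable_word_value1 cP).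
move=> c0 [r1E r2E _]; case: c1 c0 t1E {cP} => //; case: r3 r1E r2E => //.
case: c3 t2E => //; case: r1 => //; case: r2 => //; rewrite !cats0 => t2E _ _ _ ->.
by apply: (inv_inj (winvK syl_invK)).
Qed.

(** Existence: the letters of the reduced word of g are multiplied one after the
    other, by [syllable_word_mul]. *)
Lemma syllablesP g :
  syllable_word (syllables x g) /\ value syl_value (syllables x g) = g.
Proof.
suff [t tP] : exists t, syllable_word t /\ value syl_value t = g.
  by rewrite /syllables; case: xgetP => [_ _ //|/(_ t)].
have [[gB _] <-] := rwordP B_free g; elim: (rword B g) gB => [|a s IHs] sB.
  by exists [::]; rewrite value_nil big_nil.
have [|t [tP tE]] := IHs; first by move=> b bs; apply: sB; rewrite inE bs orbT.
have [p [p0 pE]] : exists p, p.2 != 0 /\ syl_value p = a.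
  have := sB _ (mem_head a s); rewrite BE => -[[i _ <-]|[_ [i _ <-] <-]].
    by exists (i, 1); rewrite /syl_value /= expg1.
  by exists (i, -1); rewrite /syl_value /= expg1.
have pP : syllable_word [:: p] by split; rewrite //= p0.
have [c1 [c2 [c3 [r1 [r2 [r3 [_ _ cP cE _]]]]]]] := syllable_word_mul pP tP.
exists (c1 ++ r3 ++ c3); split=> //.
by rewrite cE tE value_cons value_nil mulg1 pE big_cons.
Qed.

Lemma syllables_thin_triangles : thin_triangles syl_inv (syllables x).
Proof.
exists 1%N => g h.
have [gP gE] := syllablesP g; have [hP hE] := syllablesP h.
have [ghP ghE] := syllablesP (g * h)%g.
have [c1 [c2 [c3 [r1 [r2 [r3 [E1 E2 cP cE [r1E r2E r3le]]]]]]]] :=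
  syllable_word_mul gP hP.
exists c1, c2, c3, r1, r2, r3; split; rewrite ?r1E ?r2E //.
by apply: syllable_word_inj => //; rewrite cE gE hE.
Qed.

End Syllables.

Lemma cup_rolli_eq0 (R : realType) (F : groupType) (B : set F)
    (B_free : free_generating_set B) (phi : F -> R) : is_rolli B phi ->
  forall (phi_qm : quasimorphism phi) k (alpha : Hb R F k), (0 < k)%N ->
  cup (Hb_class (qm_cocycle phi_qm)) alpha = 0.
Proof.
move=> [n [x [lambda [x_inj BE lamB lamN phiE]]]].
apply: (@cup_eq0_of_letters _ _ _ (syl_value x) (@syl_inv n) _ (syllables x) _ _
  (fun p => lambda p.1 p.2)) => //.
- exact: syl_value_inv.
- by move=> g; have [] := syllablesP B_free BE g.
- exact: syllables_thin_triangles B_free x_inj BE.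
- have [M MP] := choice lamB; exists (\sum_j `|M j|) => -[i m] /=.
  rewrite (bigD1 i) //= (le_trans (MP i m)) // (le_trans (ler_norm _)) //.
  by rewrite lerDl sumr_ge0.
- by move=> p; apply: lamN.
Qed.

Theorem theoremA (R : realType) (F : groupType) (B : set F)
    (B_free : free_generating_set B)
    (F_nonabelian : exists g h : F, (g * h)%g <> (h * g)%g)
    (k : nat) (k_gt0 : (0 < k)%N) (alpha : Hb R F k)
    (phi : F -> R) (phi_qm : quasimorphism phi)
    (phi_type : is_decomposable B phi \/ is_brooks B phi \/ is_rolli B phi) :
  cup (Hb_class (qm_cocycle phi_qm)) alpha = 0.
Proof.
case: phi_type => [phi_dec|[phi_brooks|phi_rolli]].
- exact: cup_decomposable_eq0 B_free _ phi_dec _ _ _ k_gt0.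
- exact: cup_brooks_eq0 B_free _ phi_brooks _ _ _ k_gt0.
- exact: cup_rolli_eq0 B_free _ phi_rolli _ _ _ k_gt0.
Qed.
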